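(* Let $c\geq 1$ and let $\mathbb{F}$ be a field. Let $A$ be a nonzero finite-dimensional $c$-nilpotent Lie algebra over $\mathbb{F}$. View $A$ as a $c$-nilpotent Lazard Lie algebra (LLA) by setting $P_i(A)=\gamma_i(A)$ for $1\leq i\leq c+1$. Let $\langle x\rangle$ be the $1$-dimensional abelian LLA over $\mathbb{F}$ generated by $x$ in which $x$ is at level $1$ (i.e. $P_1(\langle x\rangle)=\langle x\rangle$ and $P_i(\langle x\rangle)=0$ for $2\leq i\leq c+1$). Let $B=\langle x\rangle\otimes_0 A$ be the free amalgam of $\langle x\rangle$ and $A$ over the zero LLA. Then $B$ is finite-dimensional and $\gamma_i(B)=Z_{c+1-i}(B)$ for all $i=1,\ldots,c$.
   Context: A Lie algebra is $c$-nilpotent if its nilpotency class is at most $c$. For a Lie algebra $L$, $\gamma_1(L)=L$, $\gamma_{i+1}(L)=[L,\gamma_i(L)]$ is the lower central series, and $Z_0(L)=0$, $Z_{i+1}(L)=\{a\in L: [a,b]\in Z_i(L)\text{ for all } b\in L\}$ is the upper central series. A $c$-nilpotent Lazard Lie algebra ($c$-LLA, or LLA) over $\mathbb{F}$ is a Lie algebra $L$ over $\mathbb{F}$ equipped with a chain of distinguished subalgebras $L=P_1(L)\geq P_2(L)\geq\cdots\geq P_{c+1}(L)=0$ such that $[P_i(L),P_j(L)]\leq P_{i+j}(L)$ for all $i,j$, where $P_k(L)=0$ for $k>c$. An LLA homomorphism $f:L\to M$ is a Lie algebra homomorphism with $f(P_i(L))\subseteq P_i(M)$ for all $i$; an LLA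 embedding is an injective Lie algebra homomorphism such that $a\in P_i(L)\iff f(a)\in P_i(M)$ for all $a\in L$ and all $i$. The level of a nonzero element is the maximal $i$ such that it lies in $P_i$. Let $A,B,C$ be LLAs with embeddings $f_0:C\to A$, $g_0:C\to B$. An LLA $S$ is a free amalgam of $A$ and $B$ over $C$ if: (1) there are LLA embeddings $f_1:A\to S$, $g_1:B\to S$ with $f_1\circ f_0=g_1\circ g_0$; (2) $S$ is generated as a Lie algebra by $f_1(A)\cup g_1(B)$; (3) $f_1(A)\cap g_1(B)=(f_1\circ f_0)(C)$; (4) for every LLA $D$ and LLA homomorphisms $f:A\to D$, $g:B\to D$ with $f\circ f_0=g\circ g_0$ there is a unique LLA homomorphism $h:S\to D$ with $h\circ f_1=f$ and $h\circ g_1=g$. The free amalgam exists (by earlier work) and is unique up to isomorphism; it is denoted $A\otimes_C B$. Here all LLAs are $c$-nilpotent LLAs over $\mathbb{F}$ for the fixed $c$. *)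

(* Defs.v *)
From HB Require Import structures.
From mathcomp Require Import all_boot all_algebra.
From mathcomp Require Import boolp classical_sets.

Set Implicit Arguments.
Unset Strict Implicit.
Unset Printing Implicit Defensive.

Import GRing.Theory.

Local Open Scope classical_set_scope.
Local Open Scope ring_scope.

HB.mixin Record isLieAlgebra (F : fieldType) L of GRing.Lmodule F L := {
  bracket : L -> L -> L;
  bracket_linearr : forall x, linear (bracket x);
  bracket_linearl : forall y, linear (bracket^~ y);
  bracket_alt : forall x, bracket x x = 0;
  bracket_jacobi : forall x y z,
    bracket x (bracket y z) + bracket y (bracket z x)
      + bracket z (bracket x y) = 0
}.

#[short(type="lieAlgebraType")]
HB.structure Definition LieAlgebra (F : fieldType) :=
  { L of isLieAlgebra F L & GRing.Lmodule F L }.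

Definition finite_dimensional (F : fieldType) (V : lmodType F) : Prop :=
  exists n, inhabited (Vector.axiom n V).

Section LieAlgebraTheory.
Variables (F : fieldType) (L : lieAlgebraType F).
Implicit Types (U V : set L) (x y z : L).

Definition is_subspace U : Prop := submod_closed (mem U).

Definition is_subalgebra U : Prop :=
  is_subspace U /\ forall x y, U x -> U y -> U (bracket x y).

Definition span U : set L := smallest is_subspace U.

Definition generated_subalgebra U : set L := smallest is_subalgebra U.

Definition lie_prod U V : set L := span [set bracket x y | x in U & y in V].

(* The series starts at index 1; index 0 is a junk value. *)
Fixpoint lower_central (i : nat) : set L :=
  if i is (_.+1 as j).+1 then lie_prod setT (lower_central j) else setT.

Fixpoint upper_central (i : nat) : set L :=
  if i is j.+1 then [set a | forall b, upper_central j (bracket a b)]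
  else [set 0].

Definition nilpotent_class_le (c : nat) : Prop :=
  lower_central c.+1 = [set 0].

Lemma is_subspaceP U :
  is_subspace U <->
  U 0 /\ forall (a : F) x y, U x -> U y -> U (a *: x + y).
Proof.
split=> -[U0 UD]; split.
- by move: U0; rewrite inE.
- by move=> a x y Ux Uy; apply/set_mem/UD; apply/mem_set.
- by apply/mem_set.
- by move=> a x y /set_mem Ux /set_mem Uy; apply/mem_set/UD.
Qed.

Lemma is_subspaceB U x y : is_subspace U -> U x -> U y -> U (x - y).
Proof.
move=> /is_subspaceP[_ UD] Ux Uy.
by rewrite addrC -scaleN1r; apply: UD.
Qed.

Lemma span_subspace U : is_subspace (span U).
Proof.
apply/is_subspaceP; split; first by move=> W [/is_subspaceP[]].
move=> a x y Ux Uy W [WS UW]; have /is_subspaceP[_ WD] := WS.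
by apply: WD; [apply: Ux | apply: Uy].
Qed.

Lemma lie_prod_sub U V W :
  is_subspace W -> (forall x y, U x -> V y -> W (bracket x y)) ->
  lie_prod U V `<=` W.
Proof.
by move=> WS UVW; apply: smallest_sub => // _ [x Ux [y Vy <-]]; apply: UVW.
Qed.

Lemma mem_lie_prod U V x y : U x -> V y -> lie_prod U V (bracket x y).
Proof. by move=> Ux Vy W [_]; apply; exists x => //; exists y. Qed.

Lemma lower_central_subspace i : is_subspace (lower_central i).
Proof.
by case: i => [|[|i]]; [apply/is_subspaceP | apply/is_subspaceP |
  apply: span_subspace].
Qed.

Lemma lower_centralS i :
  (0 < i)%N -> lower_central i.+1 = lie_prod setT (lower_central i).
Proof. by case: i. Qed.

Lemma lower_central_decr i :
  (0 < i)%N -> lower_central i.+1 `<=` lower_central i.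
Proof.
elim: i => [//|[//|i] IHi _].
rewrite [X in X `<=` _]lower_centralS //.
apply: lie_prod_sub; first exact: lower_central_subspace.
by move=> x y _ /(IHi isT) y_i; rewrite lower_centralS //; apply: mem_lie_prod.
Qed.

Lemma bracket0r x : bracket x 0 = 0.
Proof.
by rewrite -[X in bracket x X](subrr 0) addrC -scaleN1r
  bracket_linearr scaleN1r addNr.
Qed.

Lemma bracket0l y : bracket 0 y = 0.
Proof.
by rewrite -[X in bracket X y](subrr 0) addrC -scaleN1r
  bracket_linearl scaleN1r addNr.
Qed.

Lemma bracketC x y : bracket x y = - bracket y x.
Proof.
apply/eqP; rewrite -addr_eq0; apply/eqP.
have addl u v w : bracket (u + v) w = bracket u w + bracket v w.
  by have := bracket_linearl w 1 u v; rewrite !scale1r.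
have addr u v w : bracket w (u + v) = bracket w u + bracket w v.
  by have := bracket_linearr w 1 u v; rewrite !scale1r.
have := bracket_alt (x + y).
by rewrite addl !addr !bracket_alt add0r addr0.
Qed.

Lemma bracketN x y : bracket x (- y) = - bracket x y.
Proof.
by have := bracket_linearr x (-1) y 0; rewrite bracket0r !addr0 !scaleN1r.
Qed.

Lemma bracketA x y z :
  bracket (bracket x y) z = bracket x (bracket y z) - bracket y (bracket x z).
Proof.
have := bracket_jacobi x y z.
rewrite (bracketC z x) bracketN (bracketC z (bracket x y)) => /eqP.
by rewrite subr_eq0 => /eqP.
Qed.

Lemma lower_central_lie_prod i j : (0 < i)%N -> (0 < j)%N ->
  lie_prod (lower_central i) (lower_central j) `<=` lower_central (i + j)%N.
Proof.
elim: i j => [//|[|i] IHi] j _ j_gt0.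
  by rewrite add1n (lower_centralS j_gt0); apply: subset_refl.
apply: lie_prod_sub; first exact: lower_central_subspace.
move=> x y x_i y_j; move: x x_i; rewrite lower_centralS //.
pose W := [set x | lower_central (i.+2 + j)%N (bracket x y)].
have LS := lower_central_subspace (i.+2 + j)%N.
change (lie_prod setT (lower_central i.+1) `<=` W).
apply: lie_prod_sub.
  apply/is_subspaceP; have /is_subspaceP[L0 LD] := LS; split.
    by rewrite /W /= bracket0l.
  by move=> a u v Wu Wv; rewrite /W /= bracket_linearl; exact: LD Wu Wv.
move=> l a _ a_i; rewrite /W /= bracketA; refine (is_subspaceB LS _ _).
  rewrite addSn lower_centralS //; refine (mem_lie_prod _ _) => //.
  exact: (IHi j isT j_gt0 _ (mem_lie_prod a_i y_j)).
rewrite addSnnS; apply: (IHi j.+1 isT isT); refine (mem_lie_prod a_i _).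
by rewrite lower_centralS //; refine (mem_lie_prod _ y_j).
Qed.

Lemma lower_central_subalgebra i : (0 < i)%N ->
  is_subalgebra (lower_central i).
Proof.
move=> i_gt0; split; first exact: lower_central_subspace.
move=> x y _ y_i; apply: lower_central_decr => //.
by rewrite lower_centralS //; apply: mem_lie_prod.
Qed.

Lemma lower_central_eq0 c i : nilpotent_class_le c -> (c < i)%N ->
  lower_central i = [set 0].
Proof.
move=> Lc c_lt_i; apply/seteqP; split; last first.
  by move=> _ ->; have /is_subspaceP[] := lower_central_subspace i.
rewrite -Lc -(subnK c_lt_i); elim: (i - c.+1)%N => [|k IHk] //.
by apply: subset_trans IHk; rewrite addSn; apply: lower_central_decr;
  rewrite addnS.
Qed.

End LieAlgebraTheory.

Arguments lower_central {F} L i _.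
Arguments upper_central {F} L i _.

(* The distinguished subalgebras are indexed by i >= 1; the value of the
   filtration at index 0 is irrelevant and is never used. *)
Record LLA (c : nat) (F : fieldType) := MkLLA {
  lla_lie :> lieAlgebraType F;
  P : nat -> set lla_lie;
  lla_subalgebra : forall i, (0 < i)%N -> is_subalgebra (P i);
  lla_full : P 1 = setT;
  lla_chain : forall i, (0 < i)%N -> P i.+1 `<=` P i;
  lla_trivial : forall k, (c < k)%N -> P k = [set 0];
  lla_prod : forall i j, (0 < i)%N -> (0 < j)%N ->
    lie_prod (P i) (P j) `<=` P (i + j)%N
}.
Arguments P {c F} L i _ : rename.

Section Morphisms.
Variables (c : nat) (F : fieldType).

Record LLA_hom (L M : LLA c F) := MkLLAHom {
  hom_fun :> {linear L -> M};
  hom_bracket : {morph hom_fun : x y / bracket x y};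
  hom_P : forall i, (0 < i)%N -> hom_fun @` P L i `<=` P M i
}.

Record LLA_embedding (L M : LLA c F) := MkLLAEmbedding {
  emb_fun :> {linear L -> M};
  emb_bracket : {morph emb_fun : x y / bracket x y};
  emb_inj : injective emb_fun;
  emb_P : forall i (a : L), (0 < i)%N -> P L i a <-> P M i (emb_fun a)
}.

Definition is_free_amalgam (A B C : LLA c F)
    (f0 : LLA_embedding C A) (g0 : LLA_embedding C B) (S : LLA c F) : Prop :=
  exists (f1 : LLA_embedding A S) (g1 : LLA_embedding B S),
    [/\ f1 \o f0 =1 g1 \o g0,
        generated_subalgebra (range f1 `|` range g1) = setT,
        range f1 `&` range g1 = range (f1 \o f0) &
        forall (D : LLA c F) (f : LLA_hom A D) (g : LLA_hom B D),
          f \o f0 =1 g \o g0 ->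
          exists h : LLA_hom S D,
            (h \o f1 =1 f /\ h \o g1 =1 g) /\
            forall h' : LLA_hom S D,
              h' \o f1 =1 f -> h' \o g1 =1 g -> h' =1 h].

End Morphisms.

Section LowerCentralLLA.
Variables (c : nat) (F : fieldType) (A : lieAlgebraType F).
Hypothesis A_nil : nilpotent_class_le A c.

Definition lower_central_LLA : LLA c F :=
  @MkLLA c F A (lower_central A) (@lower_central_subalgebra F A) erefl
    (@lower_central_decr F A)
    (fun k => @lower_central_eq0 F A c k A_nil)
    (@lower_central_lie_prod F A).

End LowerCentralLLA.

Definition abelian_lie (F : fieldType) (V : lmodType F) : Type := V.

Section AbelianLie.
Variables (F : fieldType) (V : lmodType F).

HB.instance Definition _ := GRing.Lmodule.on (abelian_lie V).

Let bracket0 (x y : abelian_lie V) : abelian_lie V := 0.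

Fact bracket0_linearr x : linear (bracket0 x).
Proof. by move=> a u v; rewrite /bracket0 scaler0 addr0. Qed.

Fact bracket0_linearl y : linear (bracket0^~ y).
Proof. by move=> a u v; rewrite /bracket0 scaler0 addr0. Qed.

Fact bracket0_alt x : bracket0 x x = 0.
Proof. by []. Qed.

Fact bracket0_jacobi x y z :
  bracket0 x (bracket0 y z) + bracket0 y (bracket0 z x)
    + bracket0 z (bracket0 x y) = 0.
Proof. by rewrite /bracket0 !addr0. Qed.

HB.instance Definition _ := isLieAlgebra.Build F (abelian_lie V)
  bracket0_linearr bracket0_linearl bracket0_alt bracket0_jacobi.

End AbelianLie.

Section AbelianLLA.
Variables (c : nat) (F : fieldType) (V : lmodType F).
Hypothesis c_gt0 : (0 < c)%N.

Definition level1 (i : nat) : set (abelian_lie V) :=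
  if (i <= 1)%N then setT else [set 0].

Fact level1_subspace i : is_subspace (level1 i).
Proof.
apply/is_subspaceP; rewrite /level1; case: ifP => // _.
by split=> // a x y -> ->; rewrite scaler0 addr0.
Qed.

Fact level1_subalgebra i : (0 < i)%N -> is_subalgebra (level1 i).
Proof.
move=> _; split; first exact: level1_subspace.
by move=> x y _ _; have /is_subspaceP[] := level1_subspace i.
Qed.

Fact level1_chain i : (0 < i)%N -> level1 i.+1 `<=` level1 i.
Proof.
case: i => [//|i] _ _ ->.
by have /is_subspaceP[] := level1_subspace i.+1.
Qed.

Fact level1_trivial k : (c < k)%N -> level1 k = [set 0].
Proof. by move=> /(leq_ltn_trans c_gt0); rewrite /level1 ltnNge => /negPf->. Qed.

Fact level1_prod i j : (0 < i)%N -> (0 < j)%N ->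
  lie_prod (level1 i) (level1 j) `<=` level1 (i + j)%N.
Proof.
move=> _ _; apply: lie_prod_sub; first exact: level1_subspace.
by move=> x y _ _; have /is_subspaceP[] := level1_subspace (i + j)%N.
Qed.

Definition abelian_LLA : LLA c F :=
  @MkLLA c F (abelian_lie V) level1 level1_subalgebra erefl level1_chain
    level1_trivial level1_prod.

End AbelianLLA.

Definition line_LLA (c : nat) (F : fieldType) (c_gt0 : (0 < c)%N) : LLA c F :=
  abelian_LLA F^o c_gt0.

Definition zero_LLA (c : nat) (F : fieldType) (c_gt0 : (0 < c)%N) : LLA c F :=
  abelian_LLA 'rV[F]_0 c_gt0.

Section ZeroEmbedding.
Variables (c : nat) (F : fieldType) (c_gt0 : (0 < c)%N) (L : LLA c F).

Let zero_map : {linear zero_LLA F c_gt0 -> L} := \0%R.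

Fact zero_LLA_eq0 (x : zero_LLA F c_gt0) : x = 0.
Proof. exact: thinmx0. Qed.

Fact zero_map_bracket : {morph zero_map : x y / bracket x y}.
Proof. by move=> x y /=; rewrite bracket0l. Qed.

Fact zero_map_inj : injective zero_map.
Proof. by move=> x y _; rewrite (zero_LLA_eq0 x) (zero_LLA_eq0 y). Qed.

Fact zero_map_P i (a : zero_LLA F c_gt0) : (0 < i)%N ->
  P (zero_LLA F c_gt0) i a <-> P L i (zero_map a).
Proof.
move=> i_gt0; have [/is_subspaceP[L0 _] _] := lla_subalgebra L i_gt0.
split=> // _; rewrite (zero_LLA_eq0 a).
by have [/is_subspaceP[]] := lla_subalgebra (zero_LLA F c_gt0) i_gt0.
Qed.

Definition zero_embedding : LLA_embedding (zero_LLA F c_gt0) L :=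
  MkLLAEmbedding zero_map_bracket zero_map_inj zero_map_P.

End ZeroEmbedding.

(* Main.v *)
Require Import Defs.
From HB Require Import structures.
From mathcomp Require Import all_boot all_algebra.
From mathcomp Require Import boolp classical_sets functions.
From mathcomp Require Import zify.

Set Implicit Arguments.
Unset Strict Implicit.
Unset Printing Implicit Defensive.

Import GRing.Theory.

Local Open Scope classical_set_scope.
Local Open Scope ring_scope.

(** The algebra B is generated by x and the image of A, and it is universal
    among the c-nilpotent LLAs receiving x and A: any element d of an LLA D and
    any Lie morphism A -> D come from a unique morphism B -> D.  Since the
    n-fold brackets of generators span gamma_n modulo gamma_(n+1), B is finite
    dimensional.  The inclusion of gamma_i in Z_(c+1-i) holds in any Lie algebra
    of class at most c, so everything rests on the converse inclusion, and this
    follows from one statement about x (lemma [bracket_x_level]): for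
    1 <= m <= c,

      if [b, x] lies in gamma_(m+1)(B), then b lies in F x + gamma_m(B).

    Indeed, if b is in Z_(k+1), then by induction all [b, z] lie in
    gamma_(m+1) with m = c - k, so b = k0 x modulo gamma_m.  If m > 1, choose y
    in A outside gamma_2(A).  Were k0 nonzero, [y, x] would be in gamma_3, so y
    would be in F x + gamma_2(B), hence in gamma_2(B) by comparing degrees in x,
    hence in gamma_2(A) by retracting B onto A.

    To prove the statement about x, suppose that V is a filtered B-module of
    length m (elements of level i raise the filtration by i, and the m-th step
    is 0) with a vector v such that x v = 0 and such that only the elements of
    F x + gamma_m(B) kill v.  Let B act on W = Hom(V, V) by (b t)(u) = - t(b u)
    and form the semidirect product of B and W, which is an LLA.
    Universality gives a morphism from B sending x to (x, id) and a in A to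
    (a, 0).  It has the form b |-> (b, d b).  Evaluating the W-component of the
    image of [b, x] at v gives - b v + (d b)(x v) = - b v; when [b, x] is in
    gamma_(m+1) this component belongs to the zero step of W, so b v = 0 and b
    is in F x + gamma_m(B).

    Such a V could be obtained from the Poincare-Birkhoff-Witt theorem as a
    truncation of U(B) / U(B) x; here it is built by coinduction.  If C is a
    subspace between two consecutive steps P_w and P_(w+1) of the filtration
    and y lies in P_w, then C is an ideal of C + F y, and a C-module M yields a
    (C + F y)-module on the sequences of elements of M, where y acts by the
    shift and the action of a in C is determined by a(f)(0) = a(f(0)) and
    y a = a y + [y, a].  Starting from a line on which P_m acts trivially and
    adjoining one element at a time produces a vector whose annihilator is P_m
    ([faithful_vector_extend]).  The last adjunction, that of x to the elements
    of degree 0 in x, is done with a constant term only, so that the vector is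
    killed by x ([faithful_vector_killed]). *)

(** * Subspaces and finite dimension *)

Section Submodule.
Variables (F : fieldType) (V : lmodType F).

Definition submodule (U : set V) :=
  U 0 /\ forall (k : F) u v, U u -> U v -> U (k *: u + v).

Lemma submoduleD U u v : submodule U -> U u -> U v -> U (u + v).
Proof. by move=> [_ UD] Uu Uv; rewrite -[u]scale1r; apply: UD. Qed.

Lemma submoduleZ U k u : submodule U -> U u -> U (k *: u).
Proof. by move=> [U0 UD] Uu; rewrite -[_ *: _]addr0; apply: UD. Qed.

Lemma submoduleN U u : submodule U -> U u -> U (- u).
Proof. by move=> US Uu; rewrite -scaleN1r; apply: submoduleZ. Qed.

Lemma submoduleB U u v : submodule U -> U u -> U v -> U (u - v).
Proof. by move=> US Uu Uv; apply: submoduleD => //; apply: submoduleN. Qed.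

(** Adding one line at a time, rather than a span, is what the inductive
    construction of modules consumes. *)
Definition adjoin (U : set V) (y : V) : set V :=
  [set u | exists k : F, U (u - k *: y)].

Lemma sub_adjoin U y : U `<=` adjoin U y.
Proof. by move=> u Uu; exists 0; rewrite scale0r subr0. Qed.

Lemma mem_adjoin U y : submodule U -> adjoin U y y.
Proof. by move=> [U0 _]; exists 1; rewrite scale1r subrr. Qed.

Lemma adjoin_submodule U y : submodule U -> submodule (adjoin U y).
Proof.
move=> US; split; first by apply: sub_adjoin; case: US.
move=> k u v [p Up] [q Uq]; exists (k * p + q).
suff -> : k *: u + v - (k * p + q) *: y = k *: (u - p *: y) + (v - q *: y).
  by case: US => _; apply.
by rewrite scalerBr scalerDl scalerA opprD addrACA.
Qed.

Lemma adjoin_min U y W : submodule W -> U `<=` W -> W y -> adjoin U y `<=` W.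
Proof.
move=> WS UW Wy u [k Uk]; rewrite -(subrK (k *: y) u).
by apply: submoduleD => //; [apply: UW | apply: submoduleZ].
Qed.

Lemma adjoin_id U y : submodule U -> U y -> adjoin U y = U.
Proof.
move=> US Uy; apply/seteqP; split; last exact: sub_adjoin.
exact: adjoin_min.
Qed.

Definition extend (U : set V) (s : seq V) : set V := foldl adjoin U s.

Lemma sub_extend U s : U `<=` extend U s.
Proof.
elim: s U => [|y s IHs] U; first exact: subset_refl.
exact: subset_trans (@sub_adjoin U y) (IHs _).
Qed.

Lemma extend_submodule U s : submodule U -> submodule (extend U s).
Proof.
by elim: s U => [//|y s IHs] U US; apply: IHs; apply: adjoin_submodule.
Qed.

Lemma mem_extend U s y : submodule U -> y \in s -> extend U s y.
Proof.
elim: s U => [//|z s IHs] U US; rewrite inE => /predU1P[->|ys].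
  by apply: (@sub_extend (adjoin U z) s); apply: mem_adjoin.
by apply: (IHs (adjoin U z)) => //; apply: adjoin_submodule.
Qed.

Lemma extend_min U s W : submodule W -> U `<=` W -> {in s, forall y, W y} ->
  extend U s `<=` W.
Proof.
elim: s U => [//|y s IHs] U WS UW sW.
apply: (IHs (adjoin U y)) => // [|z zs]; last by apply: sW; rewrite inE zs orbT.
by apply: adjoin_min => //; apply: sW; rewrite mem_head.
Qed.

Lemma submodule0 : submodule [set 0].
Proof. by split=> // k u v -> ->; rewrite scaler0 addr0. Qed.

Lemma submodule_sum (U : set V) n (f : 'I_n -> V) :
  submodule U -> (forall i, U (f i)) -> U (\sum_i f i).
Proof.
move=> US Uf; apply: (big_ind U) => // [|u v Uu Uv]; first by case: US.
exact: submoduleD.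
Qed.

Variables (U : set V) (US : submodule U).

(** The proof of [submodule U] is an argument so that the closure instance can
    be found from the predicate. *)
Definition submodule_pred of submodule U : {pred V} := mem U.

Fact submodule_pred_closed : submod_closed (submodule_pred US).
Proof.
have [U0 UD] := US; split; first exact/mem_set.
by move=> a x y /set_mem Ux /set_mem Uy; apply/mem_set/UD.
Qed.

HB.instance Definition _ :=
  GRing.isSubmodClosed.Build F V (submodule_pred US) submodule_pred_closed.

Record submodule_type := SubmoduleElt
  { submodule_val : V; _ : submodule_val \in submodule_pred US }.

HB.instance Definition _ := [isSub for submodule_val].
HB.instance Definition _ := [Choice of submodule_type by <:].
HB.instance Definition _ := [SubChoice_isSubLmodule of submodule_type by <:].

Fact submodule_val_linear : linear submodule_val.
Proof. exact: (linearP \val). Qed.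

HB.instance Definition _ :=
  GRing.isLinear.Build F submodule_type V _ submodule_val submodule_val_linear.

Lemma submodule_val_inj : injective submodule_val.
Proof. exact: val_inj. Qed.

Lemma submodule_valP (u : submodule_type) : U (submodule_val u).
Proof. exact/set_mem/(valP u). Qed.

Definition submodule_elt u (Uu : U u) : submodule_type :=
  SubmoduleElt (mem_set Uu).

End Submodule.

Section FiniteDimension.
Variable F : fieldType.

Lemma finite_dimensional_spanned (V : lmodType F) :
  finite_dimensional V -> exists s : seq V, forall u, extend [set 0] s u.
Proof.
move=> [n [[f f_lin [g fK gK]]]].
pose fL : {linear V -> 'rV[F]_n} :=
  HB.pack f (GRing.isLinear.Build _ _ _ _ f f_lin).
have g_lin : linear g by move=> k u v; apply: (canLR fK); rewrite f_lin !gK.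
exists [seq g (delta_mx 0 i) | i <- enum 'I_n] => u.
rewrite -(fK u) (row_sum_delta (f u)).
set W := extend _ _.
have WS : submodule W by apply: extend_submodule; apply: submodule0.
pose W' : set 'rV[F]_n := [set r | W (g r)].
have g0 : g 0 = 0 by rewrite -[LHS](congr1 g (linear0 fL)) fK.
have W'S : submodule W'.
  split=> [|k r1 r2 W1 W2]; first by rewrite /W' /= g0; case: WS.
  by rewrite /W' /= g_lin; case: WS => _; apply.
apply: (submodule_sum W'S) => i; apply: submoduleZ => //.
by apply: mem_extend; [exact: submodule0 | apply: map_f; rewrite mem_enum].
Qed.

(** The step of the induction that turns a finite spanning list into
    coordinates; a vector already in the range is skipped. *)
Lemma parametrised_adjoin (V : lmodType F) (U : set V) y n
    (f : {linear 'rV[F]_n -> V}) : injective f -> range f = U ->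
  exists n' (f' : {linear 'rV[F]_n' -> V}),
    injective f' /\ range f' = adjoin U y.
Proof.
move=> f_inj fU.
have US : submodule U.
  rewrite -fU; split=> [|k _ _ [u _ <-] [v _ <-]].
    by exists 0; rewrite ?linear0.
  by exists (k *: u + v); rewrite ?linearP.
have [Uy|yU] := pselect (U y).
  by exists n, f; rewrite adjoin_id.
pose g (r : 'rV[F]_(n + 1)) : V := f (lsubmx r) + rsubmx r 0 0 *: y.
have g_lin : linear g.
  move=> k r1 r2; rewrite /g !linearP /= !mxE.
  by rewrite scalerDl scalerDr scalerA addrACA.
pose gL : {linear 'rV[F]_(n + 1) -> V} :=
  HB.pack g (GRing.isLinear.Build _ _ _ _ g g_lin).
exists (n + 1)%N, gL; split; last first.
  apply/seteqP; split=> [_ [r _ <-]|u [k]].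
    by exists (rsubmx r 0 0); rewrite addrK -fU; exists (lsubmx r).
  rewrite -fU => -[r _ fr]; exists (row_mx r (const_mx k)) => //=.
  by rewrite /g row_mxKl row_mxKr mxE fr subrK.
have ker0 r : g r = 0 -> r = 0.
  rewrite /g => /eqP; rewrite addr_eq0 => /eqP g0.
  have r0 : rsubmx r 0 0 = 0.
    apply/eqP; apply: contra_notT yU => nz.
    rewrite -[y]scale1r -(mulVf nz) -scalerA; apply: submoduleZ => //.
    rewrite -[_ *: y]opprK -g0; apply: submoduleN => //.
    by rewrite -fU; exists (lsubmx r).
  rewrite -[r]hsubmxK; move: g0; rewrite r0 scale0r oppr0.
  rewrite -(linear0 f) => /f_inj ->.
  have -> : rsubmx r = 0 by apply/rowP => j; rewrite ord1 r0 mxE.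
  exact: row_mx0.
move=> r1 r2 /= g12; apply/eqP; rewrite -subr_eq0; apply/eqP/ker0.
by have := linearB gL r1 r2; rewrite /= g12 subrr.
Qed.

Lemma spanned_finite_dimensional (V : lmodType F) (s : seq V) :
  (forall u, extend [set 0] s u) -> finite_dimensional V.
Proof.
have : exists n (f : {linear 'rV[F]_n -> V}),
    injective f /\ range f = extend [set 0] s.
  have : exists n (f : {linear 'rV[F]_n -> V}),
      injective f /\ range f = [set 0].
    exists 0%N, \0; split=> [u v _|]; first by rewrite (thinmx0 u) (thinmx0 v).
    by apply/seteqP; split=> [_ [u _ <-] //|_ ->]; exists 0.
  elim: s [set 0] => [//|y s IHs] U [n [f [f_inj fU]]].
  exact/IHs/(parametrised_adjoin y f_inj fU).
move=> [n [f [f_inj fs]]] s_full; exists n; constructor.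
have f_surj u : exists r, f r = u.
  by have := s_full u; rewrite -fs => -[r _ <-]; exists r.
pose g u := projT1 (cid (f_surj u)).
have gK : cancel g f by move=> u; rewrite /g; case: cid.
have fK : cancel f g by move=> r; apply: f_inj; rewrite gK.
exists g; last by exists f.
by move=> k u v; apply: f_inj; rewrite linearP !gK.
Qed.

End FiniteDimension.

(** * Finitely generated nilpotent Lie algebras *)

Section Bracket.
Variables (F : fieldType) (L : lieAlgebraType F).
Implicit Types (x y z : L) (k : F).

Lemma bracketDl x y z : bracket (x + y) z = bracket x z + bracket y z.
Proof. by have := bracket_linearl z 1 x y; rewrite !scale1r. Qed.

Lemma bracketDr x y z : bracket z (x + y) = bracket z x + bracket z y.
Proof. by have := bracket_linearr z 1 x y; rewrite !scale1r. Qed.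

Lemma bracketZl k x z : bracket (k *: x) z = k *: bracket x z.
Proof. by have := bracket_linearl z k x 0; rewrite bracket0l !addr0. Qed.

Lemma bracketZr k x z : bracket z (k *: x) = k *: bracket z x.
Proof. by have := bracket_linearr z k x 0; rewrite bracket0r !addr0. Qed.

Lemma bracketNl x z : bracket (- x) z = - bracket x z.
Proof. by rewrite -scaleN1r bracketZl scaleN1r. Qed.

Lemma subspace_submodule (U : set L) : is_subspace U -> submodule U.
Proof. by move=> /is_subspaceP. Qed.

Lemma submodule_subspace (U : set L) :
  submodule U -> is_subspace U.
Proof. by move=> US; apply/is_subspaceP. Qed.

Lemma lower_central_submodule i :
  submodule (lower_central L i).
Proof. exact/subspace_submodule/lower_central_subspace. Qed.

End Bracket.

Section FiniteGeneration.
Variables (F : fieldType) (L : lieAlgebraType F) (G : seq L).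
Hypothesis G_full : forall u, extend (lower_central L 2) G u.

(** Brackets of generators of L and of gamma_k generate gamma_(k+1) modulo
    gamma_(k+2): the error terms lie in [gamma_2, gamma_k] and
    [L, gamma_(k+1)]. *)
Lemma lower_central_extend k : (0 < k)%N -> exists2 s : seq L,
  {in s, forall y, lower_central L k y} &
  lower_central L k `<=` extend (lower_central L k.+1) s.
Proof.
elim: k => [//|[|k] IHk _]; first by exists G => // u _; apply: G_full.
have [s sP sk] := IHk isT; set s' := [seq bracket g z | g <- G, z <- s].
exists s'.
  move=> _ /allpairsP[[g z] [_ zs ->]] /=.
  by apply: (@mem_lie_prod _ _ setT (lower_central L k.+1)) => //; apply: sP.
set T := extend _ _.
have TS : submodule T by apply/extend_submodule/lower_central_submodule.
have subT : lower_central L k.+3 `<=` T by apply: sub_extend.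
rewrite lower_centralS //; apply: lie_prod_sub; first exact: submodule_subspace.
have TSl z : submodule [set x | T (bracket x z)].
  split=> [|a u v Tu Tv]; first by rewrite /= bracket0l; case: TS.
  by rewrite /= bracket_linearl; case: TS => _; apply.
have TSr x : submodule [set z | T (bracket x z)].
  split=> [|a u v Tu Tv]; first by rewrite /= bracket0r; case: TS.
  by rewrite /= bracket_linearr; case: TS => _; apply.
move=> x z _ zk.
apply: (extend_min (TSl z) _ _ (G_full x)) => [u u2 /=|g gG /=].
  apply: subT; apply: (@lower_central_lie_prod _ _ 2 k.+1) => //.
  exact: mem_lie_prod.
apply: (extend_min (TSr g) _ _ (sk z zk)) => [u u2 /=|u us /=].
  by apply: subT; rewrite lower_centralS //; apply: mem_lie_prod.
apply: mem_extend; first exact: lower_central_submodule.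
by apply/allpairsP; exists (g, u).
Qed.

Lemma nilpotent_finite_dimensional c : nilpotent_class_le L c ->
  finite_dimensional L.
Proof.
move=> Lc.
suff chain d k : (0 < k)%N -> (k + d = c.+1)%N ->
    exists s, lower_central L k `<=` extend [set 0] s.
  have [//|s sL] := chain c 1%N isT.
  by apply: (spanned_finite_dimensional (s := s)) => u; apply: sL.
elim: d k => [|d IHd] k k_gt0 kE.
  by exists [::]; move: kE; rewrite addn0 => ->; rewrite Lc.
have [//||s0 s0P] := IHd k.+1; first by rewrite addSnnS.
have [s _ sP] := lower_central_extend k_gt0.
exists (s0 ++ s); apply: (subset_trans sP); apply: extend_min.
- exact/extend_submodule/submodule0.
- by rewrite /extend foldl_cat; apply: subset_trans s0P (@sub_extend _ _ _ _).
- move=> y ys; apply: mem_extend; first exact: submodule0.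
  by rewrite mem_cat ys orbT.
Qed.

End FiniteGeneration.

(** * Levels in Lazard Lie algebras *)

Section LLATheory.
Variables (c : nat) (F : fieldType) (L : LLA c F).

Lemma P_submodule i : (0 < i)%N -> submodule (P L i).
Proof. by move=> /(lla_subalgebra L)[/subspace_submodule]. Qed.

Lemma P_bracket i j a b : (0 < i)%N -> (0 < j)%N -> P L i a -> P L j b ->
  P L (i + j)%N (bracket a b).
Proof.
by move=> i0 j0 Pa Pb; apply: (lla_prod i0 j0); apply: mem_lie_prod.
Qed.

Lemma P_decr i j : (0 < i)%N -> (i <= j)%N -> P L j `<=` P L i.
Proof.
move=> i0 /subnK<-; elim: (j - i)%N => [|d IHd]; first exact: subset_refl.
by apply: subset_trans IHd; apply: lla_chain; rewrite addn_gt0 i0 orbT.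
Qed.

End LLATheory.

Section Morphism.
Variables (c : nat) (F : fieldType) (A : lieAlgebraType F) (D : LLA c F).
Variable g : {linear A -> D}.
Hypothesis g_bracket : {morph g : x y / bracket x y}.

Lemma morph_lower_central i : (0 < i)%N ->
  g @` lower_central A i `<=` P D i.
Proof.
move=> + _ [x xi <-]; elim: i x xi => [//|[|i] IHi] x xi _.
  by rewrite lla_full.
pose W := [set x | P D i.+2 (g x)].
have [D0 DD] := P_submodule D (isT : (0 < i.+2)%N).
suff : lower_central A i.+2 `<=` W by apply.
apply: lie_prod_sub.
  apply/is_subspaceP; split; first by rewrite /W /= linear0.
  by move=> k u v Wu Wv; rewrite /W /= linearP; apply: DD.
move=> a b _ bi; rewrite /W /= g_bracket -[i.+2]add1n.
by apply: P_bracket => //; [rewrite lla_full | apply: IHi].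
Qed.

End Morphism.

Section LowerCentral.
Variables (c : nat) (F : fieldType) (L : LLA c F).

Lemma lower_central_P i : (0 < i)%N ->
  lower_central L i `<=` P L i.
Proof.
move=> i_gt0 x xi.
by apply: (@morph_lower_central c F L L idfun _ i i_gt0) => //; exists x.
Qed.

Lemma LLA_nilpotent : nilpotent_class_le L c.
Proof.
apply/seteqP; split=> [x|_ ->]; last by case: (lower_central_submodule L c.+1).
by move=> /(lower_central_P (isT : (0 < c.+1)%N)); rewrite lla_trivial.
Qed.

End LowerCentral.

(** * Filtered modules and coinduction *)

Section FilteredModule.
Variables (c : nat) (F : fieldType) (L : LLA c F) (m : nat).

(** A module of length at most m on which elements of level i raise the
    filtration by i.  The axioms on the action concern the elements of C only,
    because modules are built for a growing family of subalgebras C of a fixed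
    L.  The step [fil 0] may be a proper subspace of the carrier. *)
Record filtered_module (C : set L) := FilteredModule {
  carrier :> lmodType F;
  act : L -> carrier -> carrier;
  fil : nat -> set carrier;
  act_linear : forall a, C a -> linear (act a);
  act_linearl : forall k a b u, C a -> C b ->
    act (k *: a + b) u = k *: act a u + act b u;
  act_bracket : forall a b u, C a -> C b ->
    act (bracket a b) u = act a (act b u) - act b (act a u);
  fil_submodule : forall k, submodule (fil k);
  fil_decr : forall k, fil k.+1 `<=` fil k;
  fil_trivial : fil m `<=` [set 0];
  act_fil : forall i k a u, (0 < i)%N -> C a -> P L i a -> fil k u ->
    fil (i + k)%N (act a u)
}.

End FilteredModule.

Arguments act {c F L m C} M a u : rename.
Arguments fil {c F L m C} M k u : rename.

Section Coinduction.
Variables (c : nat) (F : fieldType) (L : LLA c F) (m : nat).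

Lemma fil_le (C : set L) (M : filtered_module m C) i j : (i <= j)%N ->
  fil M j `<=` fil M i.
Proof.
move=> /subnK<-; elim: (j - i)%N => [|d IHd]; first exact: subset_refl.
by apply: subset_trans IHd; apply: fil_decr.
Qed.

Variables (C : set L) (y : L) (w : nat).
Hypotheses (CS : submodule C) (w_gt0 : (0 < w)%N) (yP : P L w y).
Hypotheses (CP : C `<=` P L w) (PC : P L w.+1 `<=` C) (yC : ~ C y).

(** The coefficient of y in C + F y, well defined as y is outside C. *)
Definition ycoord (u : L) : F := xget 0 [set k | C (u - k *: y)].

Definition rest (u : L) : L := u - ycoord u *: y.

Lemma rest_mem u : adjoin C y u -> C (rest u).
Proof. by move=> Cu; exact: (@xgetPex _ 0 [set k | C (u - k *: y)] Cu). Qed.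

Lemma ycoordE u k : C (u - k *: y) -> ycoord u = k.
Proof.
move=> Ck; have Cr : C (rest u) by apply: rest_mem; exists k.
apply/eqP; apply: contra_notT yC; rewrite -subr_eq0 => nz.
rewrite -[y]scale1r -(mulVf nz) -scalerA; apply: submoduleZ => //.
rewrite scalerBl; have := submoduleB CS Ck Cr; rewrite /rest.
by rewrite opprB addrC addrA subrK.
Qed.

Lemma ycoord_linear k u v : adjoin C y u -> adjoin C y v ->
  ycoord (k *: u + v) = k * ycoord u + ycoord v.
Proof.
move=> /rest_mem Cu /rest_mem Cv; apply: ycoordE.
suff -> : k *: u + v - (k * ycoord u + ycoord v) *: y = k *: rest u + rest v.
  by case: CS => _; apply.
by rewrite /rest scalerBr scalerDl scalerA opprD addrACA.
Qed.

Lemma ycoord0 u : C u -> ycoord u = 0.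
Proof. by move=> Cu; apply: ycoordE; rewrite scale0r subr0. Qed.

Lemma rest_linear k u v : adjoin C y u -> adjoin C y v ->
  rest (k *: u + v) = k *: rest u + rest v.
Proof.
move=> Cu Cv; rewrite /rest ycoord_linear //.
by rewrite scalerBr scalerDl scalerA opprD addrACA.
Qed.

Lemma adjoin_level u : adjoin C y u -> P L w u.
Proof.
move=> [k Ck]; rewrite -(subrK (k *: y) u).
have Pw := P_submodule L w_gt0.
by apply: submoduleD => //; [exact: CP | apply: submoduleZ].
Qed.

(** C + F y has level w >= 1, so its derived algebra has level 2 w > w and
    lies in C; hence C is an ideal of C + F y. *)
Lemma adjoin_bracket u v : P L w u -> P L w v -> C (bracket u v).
Proof.
move=> Pu Pv; apply: PC; apply: (P_decr (j := (w + w)%N)) => //.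
  by rewrite -addn1 leq_add2l.
exact: P_bracket.
Qed.

Lemma adC a : C a -> C (bracket y a).
Proof. by move=> Ca; apply: adjoin_bracket => //; apply: CP. Qed.

Variable M : filtered_module m C.

(** Identify a function on U(C + F y) that is U(C)-linear on the left with the
    sequence f(n) of its values at y^n.  Translation by y on the right becomes
    the shift, and y a = a y + [y, a] forces the recursion below for the action
    of a in C. *)
Fixpoint coact (a : L) (f : nat -> M) (n : nat) : M :=
  if n is n'.+1 then
    coact a (fun i => f i.+1) n' + coact (bracket y a) f n'
  else act M a (f 0%N).

Lemma coact_linear a k f g n : C a ->
  coact a (fun i => k *: f i + g i) n = k *: coact a f n + coact a g n.
Proof.
elim: n a f g => [|n IHn] a f g Ca /=; first exact: act_linear.
by rewrite !IHn //; [rewrite scalerDr addrACA | apply: adC].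
Qed.

Lemma coact_linearl k a b f n : C a -> C b ->
  coact (k *: a + b) f n = k *: coact a f n + coact b f n.
Proof.
elim: n a b f => [|n IHn] a b f Ca Cb /=; first exact: act_linearl.
rewrite bracketDr bracketZr !IHn //; first by rewrite scalerDr addrACA.
all: exact: adC.
Qed.

Lemma coactD a f g n : C a ->
  coact a (fun i => f i + g i) n = coact a f n + coact a g n.
Proof.
move=> Ca; have := @coact_linear a 1 f g n Ca.
by under eq_fun do rewrite scale1r; rewrite scale1r.
Qed.

(** Induction on the index: both sides satisfy the same recursion because ad y
    is a derivation. *)
Lemma coact_bracket a b f n : C a -> C b ->
  coact (bracket a b) f n = coact a (coact b f) n - coact b (coact a f) n.
Proof.
elim: n a b f => [|n IHn] a b f Ca Cb /=; first exact: act_bracket.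
have Cya := adC Ca; have Cyb := adC Cb.
have -> : bracket y (bracket a b) =
    bracket (bracket y a) b + bracket a (bracket y b).
  by rewrite bracketA subrK.
rewrite -[bracket (bracket y a) b]scale1r coact_linearl; first last.
- by apply: adjoin_bracket; apply: CP.
- by apply: adjoin_bracket; apply: CP.
rewrite scale1r (IHn a b) // (IHn (bracket y a) b) // (IHn a (bracket y b)) //.
rewrite (coactD (coact b _) (coact (bracket y b) f)) //.
rewrite (coactD (coact a _) (coact (bracket y a) f)) // !opprD.
by rewrite [LHS](AC (2*(2*2)) ((1*5*3)*(2*4*6)))%AC.
Qed.

Lemma coact_fil i k a f n : (0 < i)%N -> C a -> P L i a ->
  (forall j, fil M (k + j * w)%N (f j)) ->
  fil M (i + k + n * w)%N (coact a f n).
Proof.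
elim: n i k a f => [|n IHn] i k a f i_gt0 Ca Pa Mf /=.
  by rewrite mul0n addn0; apply: act_fil => //; have := Mf 0%N; rewrite addn0.
apply: submoduleD; first exact: fil_submodule.
  rewrite [X in fil M X](_ : _ = i + (k + w) + n * w)%N; last by lia.
  apply: IHn => // j.
  by rewrite [X in fil M X](_ : _ = k + j.+1 * w)%N; last by lia.
rewrite [X in fil M X](_ : _ = w + i + k + n * w)%N; last by lia.
apply: IHn => //; [by rewrite addn_gt0 w_gt0 | exact: adC | exact: P_bracket].
Qed.

Definition coinduced_act (u : L) (f : nat -> M) (n : nat) : M :=
  coact (rest u) f n + ycoord u *: f n.+1.

(** The index n counts powers of y, each of level w. *)
Definition coinduced_fil (k : nat) : set (nat -> M) :=
  [set f | forall n, fil M (k + n * w)%N (f n)].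

Fact coinduced_act_linear u : adjoin C y u -> linear (coinduced_act u).
Proof.
move=> /rest_mem Cu k f g; apply/funext => n.
rewrite /coinduced_act coact_linear // !fctE /=.
by rewrite !scalerDr !scalerA [k * _]mulrC addrACA.
Qed.

Fact coinduced_act_linearl k u v f : adjoin C y u -> adjoin C y v ->
  coinduced_act (k *: u + v) f = k *: coinduced_act u f + coinduced_act v f.
Proof.
move=> Cu Cv; apply/funext => n; rewrite /coinduced_act rest_linear //.
have Cru := rest_mem Cu; have Crv := rest_mem Cv.
rewrite coact_linearl // ycoord_linear // !fctE /=.
by rewrite scalerDr scalerDl scalerA addrACA.
Qed.

Fact coinduced_act_bracket u v f : adjoin C y u -> adjoin C y v ->
  coinduced_act (bracket u v) f =
  coinduced_act u (coinduced_act v f) - coinduced_act v (coinduced_act u f).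
Proof.
move=> Cu Cv; apply/funext => n; rewrite !fctE /coinduced_act.
have Cru := rest_mem Cu; have Crv := rest_mem Cv.
have Cuv : C (bracket u v) by apply: adjoin_bracket; apply: adjoin_level.
rewrite {1}/rest (ycoord0 Cuv) !scale0r subr0 addr0.
have uE : u = rest u + ycoord u *: y by rewrite subrK.
have vE : v = rest v + ycoord v *: y by rewrite subrK.
rewrite {1}uE {1}vE {uE vE Cuv}; move: Cru Crv.
move: (rest u) (rest v) (ycoord u) (ycoord v) => a b k l Ca Cb {u v Cu Cv}.
have -> : bracket (a + k *: y) (b + l *: y) =
    k *: bracket y b + (- l *: bracket y a + bracket a b).
  rewrite bracketDl !bracketDr !bracketZl !bracketZr bracket_alt !scaler0 addr0.
  rewrite [bracket a y]bracketC scalerN -scaleNr.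
  by rewrite addrC [bracket a b + _]addrC.
have Cab : C (bracket a b) by apply: adjoin_bracket; apply: CP.
have Cya := adC Ca; have Cyb := adC Cb.
rewrite coact_linearl //; last by case: CS => _; apply.
rewrite coact_linearl // (@coact_bracket a b) //.
have shiftE a' b' l' : C a' ->
    coact a' (fun i => coact b' f i + l' *: f i.+1) n =
    l' *: coact a' (fun i => f i.+1) n + coact a' (coact b' f) n.
  by move=> Ca'; rewrite -coact_linear //; under eq_fun do rewrite addrC.
rewrite !shiftE //= !scalerDr !scalerA [l * k]mulrC scaleNr !opprD.
rewrite [RHS](AC ((2*3)*(2*3)) ((1*8)*((3*6)*((5*10)*(4*(9*(2*7)))))))%AC.
by rewrite /= !subrr !add0r.
Qed.

Fact coinduced_fil_submodule k : submodule (coinduced_fil k).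
Proof.
split=> [n|a f g Mf Mg n]; first by case: (fil_submodule M (k + n * w)).
have [_ MD] := fil_submodule M (k + n * w).
exact: MD.
Qed.

Fact coinduced_fil_decr k : coinduced_fil k.+1 `<=` coinduced_fil k.
Proof. by move=> f Mf n; apply: fil_decr; rewrite -addSn. Qed.

Fact coinduced_fil_trivial : coinduced_fil m `<=` [set 0].
Proof.
move=> f Mf; apply/funext => n; apply: (fil_trivial (f := M)).
by apply: fil_le (Mf n); rewrite leq_addr.
Qed.

Fact coinduced_act_fil i k u f : (0 < i)%N -> adjoin C y u -> P L i u ->
  coinduced_fil k f -> coinduced_fil (i + k) (coinduced_act u f).
Proof.
move=> i_gt0 Cu Pu Mf n; have Cr := rest_mem Cu.
have MS := fil_submodule M (i + k + n * w).
have [le_iw|lt_wi] := leqP i w.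
  (* Here y itself has level i, hence so do both components of u. *)
  have Piy : P L i y by apply: P_decr yP.
  apply: submoduleD => //.
    apply: coact_fil => //; apply: submoduleB => //; first exact: P_submodule.
    by apply: submoduleZ => //; apply: P_submodule.
  apply: submoduleZ => //; apply: fil_le (Mf n.+1).
  by lia.
(* A level above w forces u into C, so the shift does not occur. *)
have Cu' : C u by apply: PC; apply: P_decr Pu.
rewrite /coinduced_act /rest (ycoord0 Cu') !scale0r subr0 addr0.
exact: coact_fil.
Qed.

Definition coinduced_module : filtered_module m (adjoin C y) :=
  FilteredModule coinduced_act_linear coinduced_act_linearl
    coinduced_act_bracket coinduced_fil_submodule coinduced_fil_decr
    coinduced_fil_trivial coinduced_act_fil.

End Coinduction.

(** * Vectors with annihilator P_m *)

Section FaithfulVector.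
Variables (c : nat) (F : fieldType) (L : LLA c F) (m : nat).

Definition has_faithful_vector (C : set L) :=
  exists (M : filtered_module m C) (v : M),
    fil M 0%N v /\ forall a, C a -> act M a v = 0 -> P L m a.

(** Adding a trivial line whose generator has level exactly w gives room to
    record the coefficient of the element y of level w adjoined below. *)
Section TrivialSummand.
Variables (C : set L) (w : nat) (M : filtered_module m C).
Hypothesis lt_wm : (w < m)%N.

Definition summand_act (a : L) (u : M * F^o) : M * F^o := (act M a u.1, 0).

Definition summand_fil (k : nat) : set (M * F^o) :=
  [set u | fil M k u.1 /\ ((w < k)%N -> u.2 = 0)].

Fact summand_act_linear a : C a -> linear (summand_act a).
Proof.
move=> Ca k [u p] [v q]; rewrite /summand_act /= act_linear //.
by congr (_, _); rewrite /= scaler0 addr0.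
Qed.

Fact summand_act_linearl k a b u : C a -> C b ->
  summand_act (k *: a + b) u = k *: summand_act a u + summand_act b u.
Proof.
move=> Ca Cb; rewrite /summand_act act_linearl //.
by congr (_, _); rewrite /= scaler0 addr0.
Qed.

Fact summand_act_bracket a b u : C a -> C b ->
  summand_act (bracket a b) u =
  summand_act a (summand_act b u) - summand_act b (summand_act a u).
Proof.
move=> Ca Cb; rewrite /summand_act act_bracket //.
by congr (_, _); rewrite /= subr0.
Qed.

Fact summand_fil_submodule k : submodule (summand_fil k).
Proof.
have [M0 MD] := fil_submodule M k; split=> // a u v [Mu u0] [Mv v0].
split=> [|lt_wk]; first exact: MD.
by rewrite /= u0 // v0 // scaler0 addr0.
Qed.

Fact summand_fil_decr k : summand_fil k.+1 `<=` summand_fil k.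
Proof.
move=> u [Mu u0]; split=> [|lt_wk]; first exact: fil_decr.
by apply: u0; apply: ltnW.
Qed.

Fact summand_fil_trivial : summand_fil m `<=` [set 0].
Proof.
move=> [u p] [/= Mu p0]; congr (_, _); last exact: p0.
exact: (fil_trivial (f := M)).
Qed.

Fact summand_act_fil i k a u : (0 < i)%N -> C a -> P L i a ->
  summand_fil k u -> summand_fil (i + k) (summand_act a u).
Proof. by move=> i0 Ca Pa [Mu _]; split=> //=; apply: act_fil. Qed.

Definition summand_module : filtered_module m C :=
  FilteredModule summand_act_linear summand_act_linearl
    summand_act_bracket summand_fil_submodule summand_fil_decr
    summand_fil_trivial summand_act_fil.

End TrivialSummand.

(** In the module coinduced from M + F e, with e a trivial vector of level w,
    take the sequence v, e, 0, 0, ...  The term of index 0 of the image under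
    a + k y is a v + k e, so it vanishes only if a v = 0 and k = 0. *)
Lemma faithful_vector_adjoin C y w : submodule C -> (0 < w < m)%N ->
  P L w y -> C `<=` P L w -> P L w.+1 `<=` C ->
  has_faithful_vector C -> has_faithful_vector (adjoin C y).
Proof.
move=> CS /andP[w_gt0 lt_wm] yP CP PC [M [v [Mv v_faithful]]].
have [Cy|yC] := pselect (C y); first by rewrite adjoin_id //; exists M, v.
pose N := coinduced_module CS w_gt0 yP CP PC yC (summand_module M lt_wm).
pose f : N := fun n =>
  if n is n'.+1 then if n' is 0 then (0, 1) else 0 else (v, 0).
exists N, f; split.
  have fil0 k : fil M k 0 by case: (fil_submodule M k).
  by case=> [|[|n]]; split => //=; rewrite add0n mul1n ltnn.
move=> u Cu /(congr1 (fun g : N => g 0%N)).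
rewrite /= /coinduced_act /= /summand_act /= => -[].
rewrite scaler0 addr0 add0r => act0 ycoord0.
have {}ycoord0 : ycoord C y u = 0 by rewrite -[LHS]mulr1.
have := rest_mem Cu; move: act0; rewrite /rest ycoord0 scale0r subr0.
by move=> act0 /v_faithful; apply.
Qed.

Lemma faithful_vector_extend C s w : submodule C -> (0 < w < m)%N ->
  {in s, forall y, P L w y} -> C `<=` P L w -> P L w.+1 `<=` C ->
  has_faithful_vector C -> has_faithful_vector (extend C s).
Proof.
move=> + w_bnd; have w_gt0 : (0 < w)%N by case/andP: w_bnd.
elim: s C => [//|y s IHs] C CS sP CP PC CF.
have yP : P L w y by apply: sP; rewrite mem_head.
apply: IHs.
- exact: adjoin_submodule.
- by move=> z zs; apply: sP; rewrite inE zs orbT.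
- by apply: adjoin_min => //; apply: P_submodule.
- exact: subset_trans PC (@sub_adjoin _ _ _ _).
- exact: (faithful_vector_adjoin CS w_bnd).
Qed.

Section TrivialModule.
Hypothesis m_gt0 : (0 < m)%N.

Let triv_fil (k : nat) : set F^o := [set u | (0 < k)%N -> u = 0].

Let triv_act (_ : L) (_ : F^o) : F^o := 0.

Lemma faithful_vector_base : has_faithful_vector (P L m).
Proof.
have triv_linear a : P L m a -> linear (triv_act a).
  by move=> _ k u v; rewrite /triv_act scaler0 addr0.
have triv_linearl k a b u : P L m a -> P L m b ->
    triv_act (k *: a + b) u = k *: triv_act a u + triv_act b u.
  by move=> _ _; rewrite /triv_act scaler0 addr0.
have triv_bracket a b u : P L m a -> P L m b ->
    triv_act (bracket a b) u =
    triv_act a (triv_act b u) - triv_act b (triv_act a u).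
  by move=> _ _; rewrite /triv_act subr0.
have triv_submodule k : submodule (triv_fil k).
  split=> // a u v u0 v0 k_gt0.
  by rewrite (u0 k_gt0) (v0 k_gt0) scaler0 addr0.
have triv_decr k : triv_fil k.+1 `<=` triv_fil k by move=> u u0 _; apply: u0.
have triv_trivial : triv_fil m `<=` [set 0] by move=> u; apply.
have triv_act_fil i k a u : (0 < i)%N -> P L m a -> P L i a ->
  triv_fil k u -> triv_fil (i + k)%N (triv_act a u) by [].
pose M := FilteredModule triv_linear triv_linearl triv_bracket triv_submodule
  triv_decr triv_trivial triv_act_fil.
by exists M, (1 : F^o); split.
Qed.

End TrivialModule.

(** Descending induction on the level: P_w is obtained from P_(w+1) by
    adjoining finitely many elements of level w. *)
Lemma faithful_vector_level w : (0 < w <= m)%N ->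
  (forall k, (0 < k)%N -> exists2 s : seq L, {in s, forall y, P L k y} &
     P L k `<=` extend (P L k.+1) s) ->
  has_faithful_vector (P L w).
Proof.
move=> /andP[w_gt0 /subnKC mE] Pfin; move: (m - w)%N mE => d.
elim: d w w_gt0 => [|d IHd] w w_gt0 mE.
  by rewrite addn0 in mE; rewrite mE in w_gt0 *; exact: faithful_vector_base.
have [s sP Ps] := Pfin w w_gt0.
have -> : P L w = extend (P L w.+1) s.
  apply/seteqP; split=> //; apply: extend_min => //; first exact: P_submodule.
  exact: lla_chain.
apply: (faithful_vector_extend (w := w)) => //; first exact: P_submodule.
- by rewrite w_gt0 -mE addnS ltnS leq_addr.
- exact: lla_chain.
- by apply: IHd => //; rewrite -mE addSnnS.
Qed.

End FaithfulVector.

(** Coinducing without a trivial summand and taking the sequence v, 0, 0, ...,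
    the shift kills the vector, and the annihilator of v in C gains exactly
    F y. *)
Lemma faithful_vector_killed (c : nat) (F : fieldType) (L : LLA c F) (m : nat)
    (C : set L) (y : L) (w : nat) :
  submodule C -> (0 < w)%N -> P L w y -> C `<=` P L w -> P L w.+1 `<=` C ->
  ~ C y -> has_faithful_vector m C ->
  exists (M : filtered_module m (adjoin C y)) (v : M),
    [/\ fil M 0%N v, act M y v = 0 &
        forall u, adjoin C y u -> act M u v = 0 ->
          exists k : F, P L m (u - k *: y)].
Proof.
move=> CS w_gt0 yP CP PC yC [M [v [Mv v_faithful]]].
have [C0 _] := CS.
pose N := coinduced_module CS w_gt0 yP CP PC yC M.
pose f : N := fun n => if n is 0 then v else 0.
have fil0 k : fil M k 0 by case: (fil_submodule M k).
have y1 : ycoord C y y = 1.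
  by apply: ycoordE => //; rewrite scale1r subrr.
have act0 u : act M 0 u = 0.
  have := act_linearl (f := M) (-1) u C0 C0.
  by rewrite scaler0 addr0 scaleN1r addNr.
exists N, f; split=> [[|n] //=||u Cu /(congr1 (fun g : N => g 0%N))].
  apply/funext => n; rewrite /= /coinduced_act /rest y1 scale1r subrr scale1r.
  rewrite [f _]/= addr0; elim: n f => [|n IHn] g /=; first exact: act0.
  by rewrite bracket0r !IHn addr0.
rewrite /= /coinduced_act /= scaler0 addr0 => /(v_faithful _ (rest_mem Cu)).
by exists (ycoord C y u).
Qed.

(** * Semidirect products *)

Section Semidirect.
Variables (F : fieldType) (L : lieAlgebraType F) (W : lmodType F).
Variable rho : L -> W -> W.
Hypothesis rho_linear : forall a, linear (rho a).
Hypothesis rho_linearl : forall u, linear (rho^~ u).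
Hypothesis rho_bracket : forall a b u,
  rho (bracket a b) u = rho a (rho b u) - rho b (rho a u).

(** The representation axioms are arguments so that the Lie algebra instance
    can be inferred from the type. *)
Definition semidirect of (forall a, linear (rho a)) &
  (forall u, linear (rho^~ u)) &
  (forall a b u, rho (bracket a b) u = rho a (rho b u) - rho b (rho a u)) :
  Type := (L * W)%type.

Local Notation D := (semidirect rho_linear rho_linearl rho_bracket).

HB.instance Definition _ := GRing.Lmodule.copy D (L * W)%type.

Definition semidirect_bracket (x y : D) : D :=
  (bracket x.1 y.1, rho x.1 y.2 - rho y.1 x.2).

Fact semidirect_bracket_linearr x : linear (semidirect_bracket x).
Proof.
move=> k y z; rewrite /semidirect_bracket /=.
rewrite bracket_linearr rho_linear rho_linearl.
by congr (_, _); rewrite /= opprD addrACA scalerBr.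
Qed.

Fact semidirect_bracket_linearl y : linear (semidirect_bracket^~ y).
Proof.
move=> k x z; rewrite /semidirect_bracket /=.
rewrite bracket_linearl rho_linear rho_linearl.
by congr (_, _); rewrite /= opprD addrACA scalerBr.
Qed.

Fact semidirect_bracket_alt x : semidirect_bracket x x = 0.
Proof. by rewrite /semidirect_bracket bracket_alt subrr. Qed.

Fact semidirect_jacobi x y z :
  semidirect_bracket x (semidirect_bracket y z)
    + semidirect_bracket y (semidirect_bracket z x)
    + semidirect_bracket z (semidirect_bracket x y) = 0.
Proof.
have rhoB a u v : rho a (u - v) = rho a u - rho a v.
  by rewrite addrC -scaleN1r rho_linear scaleN1r addrC.
case: x y z => [a u] [b v] [d w]; rewrite /semidirect_bracket /=.
congr (_, _); rewrite /= ?bracket_jacobi // !rho_bracket !rhoB !opprB.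
rewrite [LHS](AC ((2*2)*(2*2)*(2*2))
  ((1*12)*((7*2)*((3*10)*((5*4)*((11*6)*(9*8)))))))%AC /=.
by rewrite !subrr !addr0.
Qed.

HB.instance Definition _ := isLieAlgebra.Build F D
  semidirect_bracket_linearr semidirect_bracket_linearl
  semidirect_bracket_alt semidirect_jacobi.

End Semidirect.

Section SemidirectLLA.
Variables (c : nat) (F : fieldType) (L : LLA c F) (W : lmodType F).
Variable rho : L -> W -> W.
Hypothesis rho_linear : forall a, linear (rho a).
Hypothesis rho_linearl : forall u, linear (rho^~ u).
Hypothesis rho_bracket : forall a b u,
  rho (bracket a b) u = rho a (rho b u) - rho b (rho a u).
Variable N : nat -> set W.
Hypothesis N_submodule : forall i, (0 < i)%N -> submodule (N i).
Hypothesis N_full : N 1 = setT.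
Hypothesis N_decr : forall i, (0 < i)%N -> N i.+1 `<=` N i.
Hypothesis N_trivial : forall i, (c < i)%N -> N i `<=` [set 0].
Hypothesis rho_N : forall i j a u, (0 < i)%N -> (0 < j)%N ->
  P L i a -> N j u -> N (i + j)%N (rho a u).

Local Notation D := (semidirect rho_linear rho_linearl rho_bracket).

Definition semidirect_P (i : nat) : set D := [set x | P L i x.1 /\ N i x.2].

Fact semidirect_P_subspace i : (0 < i)%N -> is_subspace (semidirect_P i).
Proof.
move=> i_gt0; have [L0 LD] := P_submodule L i_gt0.
have [N0 ND] := N_submodule i_gt0.
apply/is_subspaceP; split=> // k x y [Lx Nx] [Ly Ny].
by split; [apply: LD | apply: ND].
Qed.

Fact semidirect_P_bracket i j x y : (0 < i)%N -> (0 < j)%N ->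
  semidirect_P i x -> semidirect_P j y ->
  semidirect_P (i + j)%N (bracket x y).
Proof.
move=> i_gt0 j_gt0 [Lx Nx] [Ly Ny]; split; first exact: P_bracket.
apply: submoduleB; first by apply: N_submodule; rewrite addn_gt0 i_gt0.
  exact: rho_N.
by rewrite addnC; apply: rho_N.
Qed.

Fact semidirect_P_chain i : (0 < i)%N ->
  semidirect_P i.+1 `<=` semidirect_P i.
Proof. by move=> i0 x [Lx Nx]; split; [apply: lla_chain | apply: N_decr]. Qed.

Fact semidirect_P_full : semidirect_P 1 = setT.
Proof. by apply/seteqP; split=> // x _; split; rewrite ?lla_full ?N_full. Qed.

Fact semidirect_P_subalgebra i : (0 < i)%N -> is_subalgebra (semidirect_P i).
Proof.
move=> i_gt0; split; first exact: semidirect_P_subspace.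
move=> x y Px _; apply: semidirect_P_chain => //; rewrite -addn1.
by apply: semidirect_P_bracket; rewrite ?semidirect_P_full.
Qed.

Fact semidirect_P_trivial k : (c < k)%N -> semidirect_P k = [set 0].
Proof.
move=> lt_ck; apply/seteqP; split=> [[a u] [/= La Nu]|_ ->]; last first.
  have k_gt0 : (0 < k)%N by apply: leq_ltn_trans lt_ck.
  by have /is_subspaceP[] := semidirect_P_subspace k_gt0.
by congr (_, _); [move: La; rewrite lla_trivial | apply: N_trivial Nu].
Qed.

Fact semidirect_P_prod i j : (0 < i)%N -> (0 < j)%N ->
  lie_prod (semidirect_P i) (semidirect_P j) `<=` semidirect_P (i + j)%N.
Proof.
move=> i_gt0 j_gt0; apply: lie_prod_sub.
  by apply: semidirect_P_subspace; rewrite addn_gt0 i_gt0.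
by move=> x y; apply: semidirect_P_bracket.
Qed.

Definition semidirect_LLA : LLA c F :=
  @MkLLA c F D semidirect_P semidirect_P_subalgebra semidirect_P_full
    semidirect_P_chain semidirect_P_trivial semidirect_P_prod.

End SemidirectLLA.

(** * The dual module with values in the carrier *)

Section HomModule.
Variables (c : nat) (F : fieldType) (L : LLA c F) (m : nat).
Hypotheses (m_gt0 : (0 < m)%N) (le_mc : (m <= c)%N).
Variable M : filtered_module m [set: L].

(** Linear maps are taken on [fil 0] rather than on the whole carrier: this is
    what makes the steps of the dual filtration beyond m vanish. *)
Definition base := submodule_type (fil_submodule M 0).

Fact base_act_subproof a (u : base) : fil M 0 (act M a (submodule_val u)).
Proof.
apply: (@fil_le _ _ _ _ _ M 0 1) => //; rewrite -[1%N]addn0.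
by apply: act_fil => //; [rewrite lla_full | exact: submodule_valP].
Qed.

Definition base_act (a : L) (u : base) : base :=
  submodule_elt (fil_submodule M 0) (base_act_subproof a u).

Lemma base_act_linear a : linear (base_act a).
Proof.
by move=> k u v; apply: submodule_val_inj; rewrite linearP /= act_linear.
Qed.

Definition homs : set (base -> M) := [set t | linear t].

Lemma homs_submodule : submodule homs.
Proof.
split=> [k u v|k s t s_lin t_lin l u v]; first by rewrite /= scaler0 addr0.
rewrite !fctE s_lin t_lin !scalerDr !scalerA [k * l]mulrC.
by rewrite addrACA.
Qed.

Definition hom_module := submodule_type homs_submodule.

Lemma hom_linear (t : hom_module) : linear (submodule_val t).
Proof. exact: (submodule_valP t). Qed.

Lemma homB (t : hom_module) u v :
  submodule_val t (u - v) = submodule_val t u - submodule_val t v.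
Proof. by have := hom_linear t (-1) v u; rewrite !scaleN1r ![- _ + _]addrC. Qed.

Fact hom_act_subproof a (t : hom_module) :
  homs (fun u => - submodule_val t (base_act a u)).
Proof.
by move=> k u v; rewrite base_act_linear hom_linear opprD scalerN.
Qed.

Definition hom_act (a : L) (t : hom_module) : hom_module :=
  submodule_elt homs_submodule (hom_act_subproof a t).

Lemma hom_act_linear a : linear (hom_act a).
Proof.
move=> k s t; apply/submodule_val_inj/funext => u; rewrite linearP /= !fctE /=.
by rewrite opprD scalerN.
Qed.

Lemma hom_act0 a : hom_act a 0 = 0.
Proof.
by have := hom_act_linear a (-1) 0 0; rewrite scaler0 addr0 scaleN1r addNr.
Qed.

Lemma hom_act_linearl t : linear (hom_act^~ t).
Proof.
move=> k a b; apply/submodule_val_inj/funext => u; rewrite linearP /= !fctE /=.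
have -> : base_act (k *: a + b) u = k *: base_act a u + base_act b u.
  by apply: submodule_val_inj; rewrite linearP /= act_linearl.
by rewrite hom_linear opprD scalerN.
Qed.

Lemma hom_act_bracket a b t :
  hom_act (bracket a b) t = hom_act a (hom_act b t) - hom_act b (hom_act a t).
Proof.
apply/submodule_val_inj/funext => u; rewrite linearB /= !fctE /=.
have -> : base_act (bracket a b) u =
    base_act a (base_act b u) - base_act b (base_act a u).
  by apply: submodule_val_inj; rewrite linearB /= act_bracket.
by rewrite homB opprB !opprK.
Qed.

(** The dual of a decreasing filtration, reversed so that step 1 is everything
    (as [fil m] is 0) and step m + 1 is 0. *)
Definition hom_fil (i : nat) : set hom_module :=
  [set t | forall u, fil M (m.+1 - i) (submodule_val u) ->
     submodule_val t u = 0].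

Lemma hom_fil_submodule i : submodule (hom_fil i).
Proof.
split=> [u _|k s t s0 t0 u Mu]; first by rewrite linear0.
by rewrite linearP /= !fctE s0 // t0 // scaler0 addr0.
Qed.

Lemma hom0 (t : hom_module) : submodule_val t 0 = 0.
Proof. by rewrite -[X in submodule_val t X](subrr 0) homB subrr. Qed.

Lemma hom_fil_full : hom_fil 1 = setT.
Proof.
apply/seteqP; split=> // t _ u; rewrite subSS subn0 => /fil_trivial u0.
by rewrite (_ : u = 0) ?hom0 //; apply: submodule_val_inj.
Qed.

Lemma hom_fil_decr i : hom_fil i.+1 `<=` hom_fil i.
Proof.
by move=> t t0 u Mu; apply: t0; apply: fil_le Mu; apply: leq_sub2l.
Qed.

Lemma hom_fil_trivial i : (m < i)%N -> hom_fil i `<=` [set 0].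
Proof.
move=> lt_mi t t0; apply/submodule_val_inj/funext => u; rewrite linear0 /=.
apply: t0; have -> : (m.+1 - i = 0)%N by apply/eqP; rewrite subn_eq0.
exact: submodule_valP.
Qed.

Lemma hom_act_fil i j a t : (0 < i)%N -> P L i a -> hom_fil j t ->
  hom_fil (i + j) (hom_act a t).
Proof.
move=> i_gt0 Pa t0 u Mu /=; rewrite t0 ?oppr0 //=.
by apply: fil_le (act_fil i_gt0 _ Pa Mu) => //; lia.
Qed.

Definition hom_LLA : LLA c F :=
  semidirect_LLA hom_act_linear hom_act_linearl hom_act_bracket
    (fun i _ => hom_fil_submodule i) hom_fil_full (fun i _ => @hom_fil_decr i)
    (fun i lt_ci => hom_fil_trivial (leq_ltn_trans le_mc lt_ci))
    (fun i j a u i_gt0 _ => @hom_act_fil i j a u i_gt0).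

Fact inclusion_subproof : homs (fun u => submodule_val u).
Proof. by move=> k u v; rewrite linearP. Qed.

Definition inclusion : hom_module :=
  submodule_elt homs_submodule inclusion_subproof.

End HomModule.

(** * The free product of a line and a nilpotent Lie algebra *)

Section FreeAmalgam.
Variables (c : nat) (c_gt0 : (0 < c)%N) (F : fieldType) (A : lieAlgebraType F).
Variables (A_nil : nilpotent_class_le A c) (B : LLA c F).

(** The form in which the amalgam is used: generation by X and A, and existence
    of morphisms out of B.  Levels do not appear since a Lie morphism from A to
    an LLA automatically sends gamma_i(A) into P_i. *)
Definition free_over (X : B) (iota : {linear A -> B}) :=
  [/\ {morph iota : x y / bracket x y},
      forall U : set B, is_subalgebra U -> U X -> (forall a, U (iota a)) ->
        forall b, U b &
      forall (D : LLA c F) (d : D) (g : {linear A -> D}),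
        {morph g : x y / bracket x y} ->
        exists2 h : LLA_hom B D, h X = d & h \o iota =1 g].

Lemma free_amalgam_free_over :
  is_free_amalgam (zero_embedding c_gt0 (line_LLA F c_gt0))
    (zero_embedding c_gt0 (lower_central_LLA A_nil)) B ->
  exists X iota, free_over X iota.
Proof.
move=> [f1 [g1 [_ gen _ univ]]].
exists (f1 (1 : F^o)), g1; split; first exact: (emb_bracket g1).
  move=> U US UX Ui b; have : generated_subalgebra (range f1 `|` range g1) b.
    by rewrite gen.
  apply; split=> // _ [[k _ <-]|[a _ <-]] //.
  have -> : f1 k = (k : F) *: (f1 (1 : F^o) : B).
    by rewrite -linearZ /= [_ *: _]mulr1.
  by case: US => /subspace_submodule US _; apply: submoduleZ.
move=> D d g g_bracket.
pose l (k : line_LLA F c_gt0) : D := (k : F) *: d.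
have l_lin : linear l.
  by move=> k u v; rewrite /l scalerDl scalerA.
pose lL : {linear line_LLA F c_gt0 -> D} :=
  HB.pack l (GRing.isLinear.Build _ _ _ _ l l_lin).
have l_bracket : {morph lL : x y / bracket x y}.
  move=> u v; rewrite /= /l bracketZl bracketZr bracket_alt !scaler0.
  by rewrite scale0r.
have l_P i : (0 < i)%N -> lL @` P (line_LLA F c_gt0) i `<=` P D i.
  move=> i_gt0 _ [k ki <-]; move: ki; rewrite /= /level1 /l.
  case: leqP => [i_le1 _|_ ->]; last first.
    by rewrite scale0r; case: (P_submodule D i_gt0).
  by have -> : i = 1%N; [lia | rewrite lla_full].
pose f : LLA_hom (line_LLA F c_gt0) D := MkLLAHom l_bracket l_P.
pose g' : LLA_hom (lower_central_LLA A_nil) D :=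
  @MkLLAHom c F (lower_central_LLA A_nil) D g g_bracket
    (@morph_lower_central c F A D g g_bracket).
have [|h [[hf hg] _]] := univ D f g'.
  by move=> x; exact: etrans (linear0 lL) (esym (linear0 g)).
by exists h => //; rewrite -[LHS]/((h \o f1) _) hf /= /l scale1r.
Qed.

End FreeAmalgam.

Section FreeProduct.
Variables (c : nat) (c_gt0 : (0 < c)%N) (F : fieldType) (A : lieAlgebraType F).
Variables (A_nil : nilpotent_class_le A c) (B : LLA c F).
Variables (X : B) (iota : {linear A -> B}).
Hypothesis B_free : free_over X iota.

Let iota_bracket : {morph iota : x y / bracket x y}.
Proof. by case: B_free. Qed.

Let B_ind (U : set B) : is_subalgebra U -> U X -> (forall a, U (iota a)) ->
  forall b, U b.
Proof. by case: B_free => _ + _; apply. Qed.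

Let B_hom (D : LLA c F) (d : D) (g : {linear A -> D}) :
  {morph g : x y / bracket x y} ->
  exists2 h : LLA_hom B D, h X = d & h \o iota =1 g.
Proof. by case: B_free => _ _; apply. Qed.

(** Apply universality to the line itself: brackets have degree 0 in x because
    the line vanishes at level 2. *)
Lemma x_degree : exists l : {linear B -> F^o},
  [/\ l X = 1, forall a, l (iota a) = 0 &
      forall b, lower_central B 2 b -> l b = 0].
Proof.
have [|h hX hA] := @B_hom (line_LLA F c_gt0) (1 : F^o) \0.
  by move=> x y.
exists h; split=> // b b2.
have : P (line_LLA F c_gt0) 2 (h b); last by [].
by apply: (hom_P (i := 2)) => //; exists b => //; exact: lower_central_P.
Qed.

Lemma retraction : exists r : {linear B -> A},
  cancel iota r /\ {morph r : x y / bracket x y}.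
Proof.
have [|h _ hA] := @B_hom (lower_central_LLA A_nil) (0 : A) idfun.
  by move=> x y.
by exists h; split; [exact: hA | exact: (hom_bracket h)].
Qed.

Lemma generators_extend (s : seq A) : (forall a, extend [set 0] s a) ->
  forall b, extend (lower_central B 2) (X :: map iota s) b.
Proof.
move=> sA; set T := extend _ _.
have B2 := lower_central_submodule B 2.
have TS : submodule T by apply: extend_submodule.
apply: B_ind.
- split; first exact: submodule_subspace.
  move=> x y _ _; apply: sub_extend; exact: mem_lie_prod.
- by apply: mem_extend => //; rewrite mem_head.
have iS : submodule [set a | T (iota a)].
  split=> [|k u v Tu Tv]; first by rewrite /= linear0; case: TS.
  by rewrite /= linearP; case: TS => _; apply.
move=> a; apply: (extend_min iS _ _ (sA a)) => [_ ->|y ys /=].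
  by case: iS.
by apply: mem_extend => //; rewrite inE map_f ?orbT.
Qed.

Hypothesis A_fin : finite_dimensional A.

Lemma free_product_finite_dimensional : finite_dimensional B.
Proof.
have [s sA] := finite_dimensional_spanned A_fin.
exact: (nilpotent_finite_dimensional (generators_extend sA) (LLA_nilpotent B)).
Qed.

(** The action of b on v is read off from the derivation d of B with values in
    Hom(V, V) that sends x to the identity and A to 0, since the value of
    d[b, x] at a vector v killed by x is - b v. *)
Lemma bracket_x_level m b : (0 < m <= c)%N ->
  lower_central B m.+1 (bracket b X) ->
  exists k : F, lower_central B m (b - k *: X).
Proof.
move=> /andP[m_gt0 le_mc] bX.
have [->|m_gt1] : m = 1%N \/ (1 < m)%N by lia.
  by exists 0.
have [s sA] := finite_dimensional_spanned A_fin.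
have genB := generators_extend sA.
have [l [lX lA l2]] := x_degree.
pose L := lower_central_LLA (LLA_nilpotent B).
(* The hyperplane of elements of degree 0 in x is spanned by A and the
   brackets, so its module is obtained by adjoining generators of A to P_2. *)
pose C : set L := [set u | l u = 0].
have CS : submodule C.
  split=> [|k u v /= lu lv]; first exact: linear0.
  by rewrite /C /= linearP /= lu lv scaler0 addr0.
have XC : ~ C X by rewrite /C /= lX; apply/eqP/oner_neq0.
have adjX : adjoin C X = setT.
  apply/seteqP; split=> // u _; exists (l u).
  by rewrite /C /= linearB linearZ /= lX [_ *: _]mulr1 subrr.
have CE : C = extend (P L 2) (map iota s).
  have B2 := lower_central_submodule B 2.
  apply/seteqP; split; last first.
    apply: extend_min => // _ /mapP[a _ ->]; exact: lA.
  move=> u lu; have : adjoin (extend (lower_central B 2) (map iota s)) X u.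
    apply: (extend_min _ _ _ (genB u)).
    - exact/adjoin_submodule/extend_submodule.
    - exact: subset_trans (@sub_extend _ _ _ _) (@sub_adjoin _ _ _ _).
    move=> y; rewrite inE => /predU1P[->|ys].
      exact/mem_adjoin/extend_submodule.
    by apply: sub_adjoin; apply: mem_extend.
  move=> [k uk]; have k0 : k = 0.
    have : C (u - k *: X).
      by apply: (extend_min CS _ _ uk) => // _ /mapP[a _ ->]; exact: lA.
    rewrite /C /= linearB linearZ /= lu lX [_ *: _]mulr1 sub0r => /eqP.
    by rewrite oppr_eq0 => /eqP.
  by move: uk; rewrite k0 scale0r subr0.
have faithC : has_faithful_vector m C.
  rewrite CE; apply: (faithful_vector_extend (w := 1)) => //.
  - exact: (P_submodule L (i := 2)).
  - apply: faithful_vector_level; first by rewrite m_gt1.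
    by move=> k k_gt0; exact: lower_central_extend genB _ k_gt0.
have [||||M [v]] :=
  faithful_vector_killed (L := L) (y := X) (w := 1) CS _ _ _ _ XC faithC => //.
rewrite adjX in M v *; move=> [Mv Xv faith].
pose D := hom_LLA m_gt0 le_mc M.
pose g (a : A) : D := (iota a, 0).
have g_lin : linear g.
  by move=> k x y; congr (_, _); rewrite /= ?linearP // scaler0 addr0.
pose gL : {linear A -> D} := HB.pack g (GRing.isLinear.Build _ _ _ _ g g_lin).
have g_bracket : {morph gL : x y / bracket x y}.
  move=> x y; congr (_, _); first exact: iota_bracket.
  by rewrite /= !hom_act0 subr0.
have [h hX hA] := @B_hom D (X, inclusion M) gL g_bracket.
(* The first component of h is an endomorphism of B fixing the generators. *)
have h1 u : (h u).1 = u.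
  move: u; apply: B_ind => [|/=|a]; first 1 last.
  - by rewrite hX.
  - by have /= -> := hA a.
  split.
    apply/is_subspaceP; split; first by rewrite linear0.
    by move=> k x y /= hx hy; rewrite linearP /= hx hy.
  by move=> x y /= hx hy; rewrite hom_bracket /= hx hy.
have : P D m.+1 (h (bracket b X)).
  apply: (@hom_P _ _ _ _ h m.+1 isT); exists (bracket b X) => //.
  exact: lower_central_P.
rewrite hom_bracket hX => -[_ /=]; rewrite h1; move: (h b).2 => t.
pose v0 : base M := submodule_elt (fil_submodule M 0) Mv.
move=> /(_ v0); rewrite subnn => /(_ Mv); rewrite linearB /= !fctE /=.
have -> : base_act (L := L) X v0 = 0.
  by apply: submodule_val_inj; rewrite linear0.
rewrite hom0 oppr0 subr0 => /eqP; rewrite oppr_eq0 => /eqP.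
exact: faith.
Qed.

Lemma lower_sub_upper i k : (i + k = c.+1)%N -> (0 < i)%N ->
  lower_central B i `<=` upper_central B k.
Proof.
elim: k i => [|k IHk] i.
  by rewrite addn0 => -> _; rewrite (LLA_nilpotent B).
move=> ik i_gt0 a ai b; apply: (IHk i.+1) => //; first by rewrite addSnnS.
rewrite bracketC; apply: submoduleN; first exact: lower_central_submodule.
by rewrite lower_centralS //; apply: mem_lie_prod.
Qed.

Lemma outside_lower_central2 : (exists a : A, a != 0) ->
  exists a : A, ~ lower_central A 2 a.
Proof.
move=> [a a_neq0]; apply: contrapT => all2.
have A2 : lower_central A 2 = setT.
  apply/seteqP; split=> // x _; apply: contrapT => x2.
  by apply: all2; exists x.
have AT k : lower_central A k.+1 = setT.
  by elim: k => [//|k IHk]; rewrite lower_centralS // IHk.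
have : lower_central A c.+1 a by rewrite AT.
by rewrite A_nil => /eqP; exact/negP.
Qed.

Hypothesis A_neq0 : exists a : A, a != 0.

(** By induction all [b, z] lie in gamma_(i+1), so b = k0 x modulo gamma_i.
    The coefficient k0 vanishes when i > 1 because x does not commute, modulo
    gamma_3, with an element y of A outside gamma_2(A). *)
Lemma upper_sub_lower i k : (i + k = c.+1)%N -> (0 < i)%N ->
  upper_central B k `<=` lower_central B i.
Proof.
elim: k i => [|k IHk] i.
  by rewrite addn0 => -> _ _ ->; case: (lower_central_submodule B c.+1).
move=> ik i_gt0 b bk.
have bi z : lower_central B i.+1 (bracket b z).
  by apply: IHk; rewrite ?addSnnS.
have [|k0 bX] := @bracket_x_level i b _ (bi X); first by rewrite i_gt0 /=; lia.
have [i1|i_gt1] : i = 1%N \/ (1 < i)%N by lia.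
  by rewrite i1.
suff k00 : k0 = 0 by move: bX; rewrite k00 scale0r subr0.
apply: contrapT => /eqP k0_neq0.
have [y y2] := outside_lower_central2 A_neq0.
have [l [lX lA l2]] := x_degree.
have [r [rK r_bracket]] := retraction.
have decr : lower_central B i.+1 `<=` lower_central B 3.
  exact: (@P_decr _ _ (lower_central_LLA (LLA_nilpotent B)) 3 i.+1 isT i_gt1).
have S3 := lower_central_submodule B 3.
have Xy : lower_central B 3 (k0 *: bracket X (iota y)).
  rewrite -bracketZl -[_ *: X](subKr b) bracketDl bracketNl.
  apply: (submoduleB S3); apply: decr => //.
  rewrite bracketC; apply: submoduleN; first exact: lower_central_submodule.
  by rewrite lower_centralS //; apply: mem_lie_prod.
have {}Xy : lower_central B 3 (bracket (iota y) X).
  rewrite bracketC; apply: (submoduleN S3).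
  rewrite -[bracket _ _]scale1r -(mulVf k0_neq0) -scalerA.
  exact: (submoduleZ _ S3).
have [|k1 yX] := @bracket_x_level 2 (iota y) _ Xy; first by lia.
have k10 : k1 = 0.
  have := l2 _ yX; rewrite linearB linearZ /= lA lX [_ *: _]mulr1 sub0r.
  by move=> /eqP; rewrite oppr_eq0 => /eqP.
move: yX; rewrite k10 scale0r subr0 => y_B2; apply: y2; rewrite -(rK y).
have := @morph_lower_central c F B (lower_central_LLA A_nil) r r_bracket 2 isT.
by apply; exists (iota y).
Qed.

End FreeProduct.

Theorem theorem4p1 (c : nat) (c_gt0 : (0 < c)%N) (F : fieldType)
    (A : lieAlgebraType F) (A_fin : finite_dimensional A)
    (A_neq0 : exists a : A, a != 0) (A_nil : nilpotent_class_le A c)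
    (B : LLA c F)
    (B_amalgam : is_free_amalgam
       (zero_embedding c_gt0 (line_LLA F c_gt0))
       (zero_embedding c_gt0 (lower_central_LLA A_nil)) B) :
  finite_dimensional B /\
  forall i : nat, (1 <= i <= c)%N ->
    lower_central B i = upper_central B (c + 1 - i)%N.
Proof.
have [X [iota B_free]] := free_amalgam_free_over B_amalgam.
split; first exact: (free_product_finite_dimensional B_free).
move=> i /andP[i_gt0 le_ic]; have ik : (i + (c + 1 - i) = c.+1)%N by lia.
apply/seteqP; split; first exact: lower_sub_upper.
exact: (upper_sub_lower c_gt0 A_nil B_free).
Qed.
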